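(* Suppose $Y_i^\top=W_i^\top H$ for $i\ge1$, where $H$ is a fixed $K\times J$ matrix with non-negative entries and full row rank, and $\{W_i\}_{i\ge1}$ is an $\mathbb{R}_+^K$-valued process satisfying Assumption E (ergodicity and stationarity) and Assumption S (probabilistic separability). Assume, so that the normalization is defined, that $r_i:=Y_i^\top 1_J>0$ for all $i$. Let $Y_i^*=Y_i/r_i$ be the normalized $Y_i$, and let $H^*$ be the row-normalized $H$, with rows $h_1^{*\top},\dots,h_K^{*\top}$. Then $$d_{\mathrm{Haus}}\big(\mathrm{conv}\{Y_1^*,\dots,Y_n^*\},\ \mathrm{conv}\{h_1^*,\dots,h_K^*\}\big)\to 0\quad\text{almost surely as } n\to\infty,$$ where $d_{\mathrm{Haus}}$ is the Hausdorff distance.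
   Context: $\mathbb{R}_+=[0,\infty)$; $1_J$ is the $J$-vector of ones; $\mathrm{conv}$ denotes the convex hull in $\mathbb{R}^J$. Assumption E (ergodicity and stationarity): $\{W_i\}_{i\ge1}$ is a (strictly) stationary ergodic process on $\mathbb{R}_+^K$ with marginal distribution $\mathbb{P}_W$ having support $\mathbb{S}_W\subseteq\mathbb{R}_+^K$ (a point $a$ belongs to $\mathbb S_W$ if and only if every open ball around $a$ has positive $\mathbb{P}_W$-probability), and with finite mean $\mu=\mathbb{E}(W_i)$. No independence across $i$ is assumed. Assumption S (probabilistic separability): there exist constants $c_k>0$ such that $c_ke_k\in\mathbb{S}_W$ for every $k=1,\dots,K$, where $e_k$ is the $k$th canonical basis vector of $\mathbb{R}^K$. Row normalization of $H$: with $h_k^\top$ the $k$th row of $H$ and $d_k>0$ the sum of its entries, $h_k^*=h_k/d_k$; equivalently $H^*=D_h^{-1}H$ with $D_h=\mathrm{diag}(d_1,\dots,d_K)$. *)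

(* Defs.v *)
From mathcomp Require Import all_boot all_order all_algebra.
From mathcomp Require Import all_classical all_reals all_analysis.

Set Implicit Arguments.
Unset Strict Implicit.
Unset Printing Implicit Defensive.

Import Order.TTheory GRing.Theory Num.Theory.
Import numFieldNormedType.Exports.

Local Open Scope classical_set_scope.
Local Open Scope ring_scope.

(* The library norm on matrices is the sup norm. *)
Definition enorm (R : realType) (n : nat) (v : 'rV[R]_n) : R :=
  Num.sqrt (\sum_(j < n) v 0 j ^+ 2).

Definition eball (R : realType) (n : nat) (a : 'rV[R]_n) (e : R)
    : set 'rV[R]_n :=
  [set x | enorm (x - a) < e].

Definition conv_hull (R : realType) (n : nat) (A : set 'rV[R]_n)
    : set 'rV[R]_n :=
  smallest (@convex_set R 'rV[R]_n) A.

Definition dist_to (R : realType) (n : nat) (x : 'rV[R]_n) (A : set 'rV[R]_n)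
    : \bar R :=
  ereal_inf [set (enorm (x - a))%:E | a in A].

(* Extended-real valued, so that no nonemptiness or boundedness is required:
   it is +oo when exactly one of the two sets is empty. *)
Definition hausdorff_dist (R : realType) (n : nat) (A B : set 'rV[R]_n)
    : \bar R :=
  Order.max (ereal_sup [set dist_to x B | x in A])
            (ereal_sup [set dist_to y A | y in B]).

Definition normalize (R : realType) (n : nat) (v : 'rV[R]_n) : 'rV[R]_n :=
  (\sum_(j < n) v 0 j)^-1 *: v.

Definition row_normalize (R : realType) (m n : nat) (H : 'M[R]_(m, n))
    : 'M[R]_(m, n) :=
  \matrix_(k < m) normalize (row k H).

(* R^n with its Borel sigma-algebra; the topology of the sup norm is the
   Euclidean one. *)
Definition borel_rV (R : realType) (n : nat) :=
  g_sigma_algebraType (@open 'rV[R]_n).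

(* A process is indexed from 0: W i is the variable of index i + 1. *)
Section process.
Context (d d' : measure_display) (Omega : measurableType d)
  (T : measurableType d') (R : realType) (P : probability Omega R).

(* The product sigma-algebra on T^nat is <<s cylinder >>. *)
Definition cylinder : set (set (nat -> T)) :=
  [set C | exists i : nat, exists2 B : set T,
     measurable B & C = [set w | B (w i)]].

Definition shift (w : nat -> T) : nat -> T := fun i => w i.+1.

Definition path_of (W : nat -> {RV P >-> T}) (omega : Omega) : nat -> T :=
  fun i => W i omega.

Definition stationary (W : nat -> {RV P >-> T}) : Prop :=
  forall A : set (nat -> T), <<s cylinder >> A ->
    P (path_of W @^-1` (shift @^-1` A)) = P (path_of W @^-1` A).

Definition ergodic (W : nat -> {RV P >-> T}) : Prop :=
  forall A : set (nat -> T), <<s cylinder >> A -> shift @^-1` A = A ->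
    P (path_of W @^-1` A) = 0%E \/ P (path_of W @^-1` A) = 1%E.

End process.

Section assumptions.
Context (d : measure_display) (Omega : measurableType d) (R : realType)
  (P : probability Omega R) (K : nat).

Definition entry (X : {RV P >-> borel_rV R K}) (k : 'I_K) : Omega -> R :=
  fun omega => (X omega : 'rV[R]_K) 0 k.

Definition nonneg_valued (W : nat -> {RV P >-> borel_rV R K}) : Prop :=
  forall i omega k, 0 <= entry (W i) k omega.

Record stationary_ergodic (W : nat -> {RV P >-> borel_rV R K}) : Prop := {
  is_stationary : stationary W ;
  is_ergodic : ergodic W ;
  has_finite_mean : exists mu : 'rV[R]_K,
    forall i k, 'E_P[entry (W i) k]%E = (mu 0 k)%:E }.

Definition law_support (X : {RV P >-> borel_rV R K}) : set 'rV[R]_K :=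
  [set a | forall e : R, 0 < e -> (0 < distribution P X (eball a e))%E].

(* The marginal law of a stationary process is read off its first variable. *)
Definition prob_separable (W : nat -> {RV P >-> borel_rV R K}) : Prop :=
  exists c : 'I_K -> R, forall k,
    0 < c k /\ law_support (W 0%N) (c k *: delta_mx 0 k).

End assumptions.

(* Main.v *)
Require Import Defs.
From mathcomp Require Import all_boot all_order all_algebra.
From mathcomp Require Import all_classical all_reals all_analysis.

Set Implicit Arguments.
Unset Strict Implicit.
Unset Printing Implicit Defensive.

Import Order.TTheory GRing.Theory Num.Theory.
Import numFieldNormedType.Exports.

Local Open Scope classical_set_scope.
Local Open Scope ring_scope.

(** Each normalized observation lies in the target polytope: if
    [r_k] is the sum of row [k] of [H], then [normalize (w *m H)] is the mean of
    the normalized rows [h_k^*] with weights proportional to [w_k r_k]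
    ([normalize_mulmx_in_hull]). So the hull of the observations is always
    contained in the hull of the [h_k^*], and only the other half of the
    Hausdorff distance matters.

    For that half it is enough that every vertex [h_k^*] be approached by some
    observation. If every vertex is within [e] of a convex set [A], then so is
    the whole hull of the vertices, because the closed [e]-thickening of [A] is
    convex ([convex_thickening]). Now [h_k^*] is the image of [c_k e_k] under
    the map [w |-> normalize (w *m H)], which is continuous there, so it
    suffices that [W_i] visits every ball around [c_k e_k].

    These balls have positive probability under the marginal law, by
    separability, and an ergodic stationary process almost surely visits any
    such set [B] ([ergodic_recurrent]): the event that [W_i] is in [B]
    infinitely often is the preimage of a shift invariant set, hence has
    probability 0 or 1, and its probability is at least that of [W_0 \in B],
    being the limit of the probabilities of the events that [B] is visited after
    time [n]. Intersecting over the countably many radii [1 / (m + 1)] and the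
    finitely many [k] gives one almost sure event on which the convergence is
    deterministic. *)

(** * Convex sets of row vectors *)

Section convexity.
Context (R : realType) (n : nat).
Implicit Types (A B C : set 'rV[R]_n) (x y : 'rV[R]_n).

Lemma convex_setP A : convex_set A <->
  (forall x y t, 0 <= t <= 1 -> A x -> A y -> A (t *: x + (1 - t) *: y)).
Proof.
split=> [cA x y t /andP[t0 t1] Ax Ay|cA x y l /set_mem Ax /set_mem Ay].
  by have /set_mem := cA x y (Itv01 t0 t1) (mem_set Ax) (mem_set Ay).
by apply/mem_set; apply: cA => //; rewrite ge0 le1.
Qed.

Lemma conv_hull_convex A : convex_set (conv_hull A).
Proof.
apply/convex_setP => x y t t01 Ax Ay C [cC AC].
by move/convex_setP : (cC); apply => //; [exact: Ax | exact: Ay].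
Qed.

(** Allowing weights of arbitrary total, as produced by normalization, makes
    this an additive statement: the pairs (s, v) with [v] in [s *: C] are closed
    under addition. *)
Lemma convex_weighted_mean C (I : finType) (a : I -> R) (c : I -> 'rV[R]_n) :
  convex_set C -> (forall i, 0 <= a i) -> (forall i, C (c i)) ->
  0 < \sum_i a i -> C ((\sum_i a i)^-1 *: \sum_i a i *: c i).
Proof.
move=> /convex_setP cC a_ge0 Cc a_gt0.
have [i0 _] : exists i0 : I, true.
  apply/existsP; apply: contraTT a_gt0 => /existsPn I0.
  by rewrite big1 ?ltxx// => i; have := I0 i.
(* The point c i0 is the witness for the empty sum, where the scale is zero. *)
pose Q s v := 0 <= s /\ exists2 x, C x & v = s *: x.
have [] : Q (\sum_i a i) (\sum_i a i *: c i).
  apply: (big_ind2 Q).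
  - by split=> //; exists (c i0) => //; rewrite scale0r.
  - move=> s u t v [s0 [x Cx ->]] [t0 [y Cy ->]]; split; first exact: addr_ge0.
    have [st0|st_neq0] := eqVneq (s + t) 0.
      have /andP[/eqP -> /eqP ->] : (s == 0) && (t == 0).
        by rewrite -paddr_eq0// st0.
      by exists x => //; rewrite addr0 !scale0r addr0.
    have st_gt0 : 0 < s + t by rewrite lt_neqAle eq_sym st_neq0 addr_ge0.
    exists (s / (s + t) *: x + (1 - s / (s + t)) *: y).
      apply: cC => //; rewrite divr_ge0 ?(ltW st_gt0)//=.
      by rewrite ler_pdivrMr// mul1r lerDl.
    rewrite scalerDr !scalerA mulrBr mulr1 mulrCA mulfV// mulr1.
    by rewrite [s + t]addrC addrK.
  - by move=> i _; split=> //; exists (c i).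
move=> _ [x Cx ->]; rewrite scalerA mulVf ?scale1r//.
by rewrite gt_eqF.
Qed.

(** Carries an approximation of the vertices of a polytope over to the whole
    polytope, without writing its points as barycentres. The sup norm is
    enough, since the Euclidean norm is controlled by it. *)
Lemma convex_thickening A (e : R) : convex_set A ->
  convex_set [set y | exists2 a, A a & `|y - a| <= e].
Proof.
move=> /convex_setP cA; apply/convex_setP => x y t.
move=> /andP[t0 t1] [a Aa xa] [b Ab yb].
exists (t *: a + (1 - t) *: b); first by apply: cA; rewrite ?t0.
rewrite opprD addrACA -!scalerBr (le_trans (ler_normD _ _))// !normrZ.
have t1' : 0 <= 1 - t by rewrite subr_ge0.
rewrite (ger0_norm t0) (ger0_norm t1').
apply: (@le_trans _ _ (t * e + (1 - t) * e)).
  by rewrite lerD// ler_wpM2l.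
by rewrite -mulrDl addrC subrK mul1r.
Qed.

End convexity.

(** * Euclidean norm and Hausdorff distance *)

Section euclidean_norm.
Context (R : realType) (n : nat).
Implicit Types (A B : set 'rV[R]_n) (x y : 'rV[R]_n).

Lemma norm_coord_le x j : `|x 0 j| <= `|x|.
Proof.
rewrite [leRHS]mx_normrE.
exact: (le_bigmax _ (fun i => `|x i.1 i.2|) (0, j)).
Qed.

Lemma norm_le_enorm x : `|x| <= enorm x.
Proof.
rewrite [leLHS]mx_normrE; apply: bigmax_le => /=; first exact: sqrtr_ge0.
move=> [i j] _ /=; rewrite (ord1 i) -sqrtr_sqr ler_wsqrtr//.
by rewrite (bigD1 j)//= lerDl sumr_ge0// => k _; exact: sqr_ge0.
Qed.

Lemma enorm_le_norm x : enorm x <= Num.sqrt n%:R * `|x|.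
Proof.
rewrite -[`|x|]ger0_norm// -sqrtr_sqr -sqrtrM// ler_wsqrtr// mulr_natl.
rewrite -[X in _ *+ X]card_ord -sumr_const ler_sum// => j _.
rewrite -[leLHS]real_normK ?num_real// lerXn2r ?nnegrE//.
exact: norm_coord_le.
Qed.

Lemma enorm_continuous : continuous (@enorm R n).
Proof.
move=> x; rewrite /enorm.
apply: (@continuous_comp _ _ _ (fun v : 'rV[R]_n => \sum_(j < n) v 0 j ^+ 2)
  Num.sqrt); last exact: sqrt_continuous.
apply: continuous_big => [|j _ {}x]; first exact: add_continuous.
apply: (@continuous_comp _ _ _ (fun v : 'rV[R]_n => v 0 j)
  (fun r : R => r ^+ 2)).
  exact: coord_continuous.
exact: exprn_continuous.
Qed.

Lemma eball_open a (e : R) : open (@eball R n a e).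
Proof.
have cont : continuous (fun x : 'rV[R]_n => enorm (x - a)).
  move=> x; apply: (@continuous_comp _ _ _ (fun x => x - a) (@enorm R n)).
    apply: (@continuousB _ _ _ id (cst a)); first exact: cvg_id.
    exact: cst_continuous.
  exact: enorm_continuous.
exact: (open_comp (fun x _ => cont x) (@open_lt R e)).
Qed.

Lemma dist_to_ge0 x A : (0 <= dist_to x A)%E.
Proof. by apply: le_ereal_inf_tmp => _ [a _ <-]; rewrite lee_fin sqrtr_ge0. Qed.

Lemma dist_to_le x A (e : R) : (exists2 a, A a & `|x - a| <= e) ->
  (dist_to x A <= (Num.sqrt n%:R * e)%:E)%E.
Proof.
move=> [a Aa xa]; apply: ge_ereal_inf; exists (enorm (x - a))%:E.
  by exists a.
by rewrite lee_fin (le_trans (enorm_le_norm _))// ler_wpM2l.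
Qed.

(** The inclusion [A `<=` B] makes the first supremum vanish. Nonemptiness of
    [A] is what excludes the value -oo of an empty supremum. *)
Lemma hausdorff_dist_bounds A B (e : R) : 0 <= e -> A !=set0 -> A `<=` B ->
  B `<=` [set y | exists2 a, A a & `|y - a| <= e] ->
  (0 <= hausdorff_dist A B <= (Num.sqrt n%:R * e)%:E)%E.
Proof.
move=> e0 [a Aa] AB BA; apply/andP; split.
  rewrite /hausdorff_dist le_max; apply/orP; left.
  apply: le_ereal_sup_tmp; exists (dist_to a B); first by exists a.
  exact: dist_to_ge0.
rewrite /hausdorff_dist ge_max.
apply/andP; split; apply: ge_ereal_sup => _ [x Hx <-].
  by apply: dist_to_le; exists x; [exact: AB | rewrite subrr normr0].
exact/dist_to_le/BA.
Qed.

End euclidean_norm.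

Lemma cvg0e_near_le (R : realType) (f : nat -> \bar R) :
  (forall e : R, 0 < e -> \forall n \near \oo, (0 <= f n <= e%:E)%E) ->
  f @ \oo --> (0%E : \bar R).
Proof.
move=> f_small U U0.
have /nbhs_ballP[e /= e0 eU] : nbhs (0 : R) (fun r => U r%:E) := U0.
have e20 : 0 < e / 2 by rewrite divr_gt0.
rewrite /nbhs/=; near=> n; rewrite /preimage/=.
have : (0 <= f n <= (e / 2)%:E)%E by near: n; exact: f_small.
move=> /andP[]; move: (f n) => [r| |]//; rewrite !lee_fin => r0 re.
suff : ball (0 : R) e r by exact: eU.
rewrite /ball/= sub0r normrN ger0_norm//.
by rewrite (le_lt_trans re)// ltr_pdivrMr// ltr_pMr// ltr1n.
Unshelve. all: by end_near.
Qed.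

(** * Recurrence of stationary ergodic processes *)

Section recurrence.
Context (d d' : measure_display) (Omega : measurableType d)
  (T : measurableType d') (R : realType) (P : probability Omega R).
Context (W : nat -> {RV P >-> T}).

Lemma stationary_law (B : set T) i : stationary W -> measurable B ->
  P (W i @^-1` B) = P (W 0%N @^-1` B).
Proof.
move=> statW mB; elim: i => // i <-.
apply: (statW [set w | B (w i)]).
by apply: sub_sigma_algebra; exists i, B.
Qed.

(** The infinitely-often event is used rather than the event that [B] is ever
    visited: the latter merely contains its preimage under the shift, while
    ergodicity speaks of sets equal to their preimage. *)
Lemma ergodic_recurrent (B : set T) : stationary W -> ergodic W ->
  measurable B -> (0 < P (W 0%N @^-1` B))%E ->
  {ae P, forall omega, exists i, B (W i omega)}.
Proof.
move=> statW ergW mB B_gt0.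
pose V := lim_sup_set (fun i => [set w : nat -> T | B (w i)]).
pose E := lim_sup_set (fun i => W i @^-1` B).
have mV : <<s (@cylinder _ T) >> V.
  apply: (@bigcap_measurable _ (g_sigma_algebraType (@cylinder _ T))) => // k _.
  apply: bigcup_measurable => i _.
  by apply: sub_sigma_algebra; exists i, B.
have shiftV : @Defs.shift _ T @^-1` V = V.
  apply/seteqP; split => [w Vw k _|w Vw k _].
    by have [i /= ki Bi] := Vw k I; exists i.+1 => //=; exact: leqW.
  (* A visit at a time i.+1 >= k.+1 is a visit of the shifted path at i >= k. *)
  by have [[//|i] /= ki Bi] := Vw k.+1 I; exists i.
have mWB i : measurable (W i @^-1` B).
  by rewrite -[X in measurable X]setTI; exact: measurable_funPT.
have mE : measurable E.
  by apply: bigcap_measurable => // k _; apply: bigcup_measurable.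
have E_gt0 : (0 < P E)%E.
  apply: (lt_le_trans B_gt0).
  have Ecvg := lim_sup_set_cvg P (fun i => W i @^-1` B) mWB.
  have {}Ecvg : P (\bigcup_(k >= n) (W k @^-1` B)) @[n --> \oo] --> P E.
    apply: Ecvg; rewrite (le_lt_trans (probability_le1 _ _)) ?ltry//.
    exact: bigcup_measurable.
  rewrite -(cvg_lim _ Ecvg)//; apply: lime_ge.
    by apply/cvg_ex; eexists; exact: Ecvg.
  apply: nearW => n; rewrite -(stationary_law n statW mB).
  apply: le_measure; rewrite ?inE//; first exact: bigcup_measurable.
  by move=> w Bw; exists n => /=.
have [E0|E1] := ergW _ mV shiftV.
  by move: E_gt0; rewrite E0 ltxx.
exists (~` E); split; first exact: measurableC.
  by rewrite probability_setC// (_ : P E = 1%E) ?subee.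
by apply: subsetC => w /(_ 0%N I)[i _ Bi]; exists i.
Qed.

End recurrence.

(** * The map [w |-> normalize (w *m H)] *)

Definition row_sum (R : realType) (m n : nat) (H : 'M[R]_(m, n)) (k : 'I_m) :=
  \sum_(j < n) H k j.

Section normalized_product.
Context (R : realType) (K J : nat) (H : 'M[R]_(K, J)).
Hypothesis H_ge0 : forall k j, 0 <= H k j.
Hypothesis H_free : row_free H.

(** A nonnegative row with zero sum vanishes, which contradicts full row
    rank. *)
Lemma row_sum_gt0 k : 0 < row_sum H k.
Proof.
rewrite lt_neqAle sumr_ge0// andbT eq_sym.
apply/eqP => /eqP; rewrite psumr_eq0// => /allP Hk0.
have /(row_free_inj H_free) : delta_mx 0 k *m H = (0 : 'rV[R]_K) *m H.
  rewrite mul0mx -rowE; apply/rowP => j; rewrite !mxE.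
  by apply/eqP; exact: (Hk0 j (mem_index_enum j)).
by move=> /rowP/(_ k)/eqP; rewrite !mxE !eqxx oner_eq0.
Qed.

Lemma sum_mulmx (w : 'rV[R]_K) :
  \sum_(j < J) (w *m H) 0 j = \sum_k w 0 k * row_sum H k.
Proof.
under eq_bigr do rewrite mxE.
by rewrite exchange_big/=; apply: eq_bigr => k _; rewrite mulr_sumr.
Qed.

Lemma row_row_normalize k :
  row k (row_normalize H) = (row_sum H k)^-1 *: row k H.
Proof.
apply/rowP => j; rewrite !mxE; congr (_^-1 * _).
by apply: eq_bigr => i _; rewrite mxE.
Qed.

Lemma normalize_mulmx (w : 'rV[R]_K) :
  normalize (w *m H) = (\sum_k w 0 k * row_sum H k)^-1 *:
    \sum_k (w 0 k * row_sum H k) *: row k (row_normalize H).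
Proof.
rewrite /normalize sum_mulmx mulmx_sum_row; congr (_ *: _).
apply: eq_bigr => k _; rewrite row_row_normalize scalerA mulfK//.
by rewrite gt_eqF// row_sum_gt0.
Qed.

Lemma normalize_mulmx_in_hull (w : 'rV[R]_K) :
  (forall k, 0 <= w 0 k) -> 0 < \sum_(j < J) (w *m H) 0 j ->
  conv_hull [set row k (row_normalize H) | k in [set: 'I_K]]
    (normalize (w *m H)).
Proof.
move=> w_ge0; rewrite sum_mulmx normalize_mulmx => ws_gt0.
apply: convex_weighted_mean => //; first exact: conv_hull_convex.
- by move=> k; rewrite mulr_ge0// ltW// row_sum_gt0.
- by move=> k; apply: sub_gen_smallest; exists k.
Qed.

Lemma normalize_mulmx_delta k (c : R) : 0 < c ->
  normalize ((c *: delta_mx 0 k) *m H) = row k (row_normalize H).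
Proof.
move=> c_gt0; rewrite -scalemxAl -rowE /normalize row_row_normalize.
under eq_bigr do rewrite 2!mxE.
by rewrite -mulr_sumr scalerA invfM mulrAC mulVf ?mul1r// gt_eqF.
Qed.

(** Numerator and total are both linear in the vector, so that the map is
    continuous wherever the total does not vanish. *)
Lemma normalize_mulmx_continuous (w : 'rV[R]_K) :
  \sum_(j < J) (w *m H) 0 j != 0 ->
  {for w, continuous (fun v : 'rV[R]_K => normalize (v *m H))}.
Proof.
move=> s_neq0.
have linear_cont (V : normedModType R) (a : 'I_K -> V) :
    {for w, continuous (fun v : 'rV[R]_K => \sum_k v 0 k *: a k)}.
  apply: continuous_big => [|k _ v]; first exact: add_continuous.
  by apply: continuousZr_tmp; exact: coord_continuous.
apply: continuousZ.
  apply: continuousV => //.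
  rewrite (_ : (fun v => _) =
    fun v : 'rV[R]_K => \sum_k v 0 k *: (row_sum H k : R^o)).
    exact: linear_cont.
  by apply/funext => v; exact: sum_mulmx.
rewrite (_ : (fun v => _) = fun v : 'rV[R]_K => \sum_k v 0 k *: row k H).
  exact: linear_cont.
by apply/funext => v; exact: mulmx_sum_row.
Qed.

Lemma normalize_mulmx_near k (c e : R) : 0 < c -> 0 < e ->
  exists2 h : R, 0 < h & forall w : 'rV[R]_K, eball (c *: delta_mx 0 k) h w ->
    `|row k (row_normalize H) - normalize (w *m H)| <= e.
Proof.
move=> c_gt0 e_gt0.
have s_neq0 : \sum_(j < J) ((c *: delta_mx 0 k : 'rV[R]_K) *m H) 0 j != 0.
  rewrite -scalemxAl -rowE; under eq_bigr do rewrite 2!mxE.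
  by rewrite -mulr_sumr mulf_neq0// gt_eqF// row_sum_gt0.
have := normalize_mulmx_continuous s_neq0.
move=> /cvgrPdist_le/(_ e e_gt0)/nbhs_ballP[h /= h_gt0 hP].
exists h => // w wh; rewrite -(normalize_mulmx_delta k c_gt0).
apply: hP; rewrite -ball_normE/= -normrN opprB.
exact: le_lt_trans (norm_le_enorm _) wh.
Qed.

End normalized_product.

Theorem theorem2 (R : realType) (d : measure_display)
  (Omega : measurableType d) (P : probability Omega R)
  (K J : nat) (H : 'M[R]_(K, J))
  (W : nat -> {RV P >-> borel_rV R K}) (Y : nat -> Omega -> 'rV[R]_J)
  (H_ge0 : forall k j, 0 <= H k j)
  (H_free : row_free H)
  (W_ge0 : nonneg_valued W)
  (W_ergodic : stationary_ergodic W)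
  (W_sep : prob_separable W)
  (YE : forall i omega, Y i omega = (W i omega : 'rV[R]_K) *m H)
  (r_gt0 : {ae P, forall omega, forall i, 0 < \sum_(j < J) Y i omega 0 j}) :
  {ae P, forall omega,
    (fun n : nat => hausdorff_dist
       (conv_hull [set normalize (Y i omega) | i in `I_n])
       (conv_hull [set row k (row_normalize H) | k in [set: 'I_K]]))
      @ \oo --> (0%E : \bar R)}.
Proof.
have [statW ergW _] := W_ergodic.
have [c cP] := W_sep.
have hits : {ae P, forall omega, forall k m, exists i,
    eball (c k *: delta_mx 0 k) m.+1%:R^-1 (W i omega : 'rV[R]_K)}.
  apply: filter_forall => k; apply: ae_foralln => m.
  apply: ergodic_recurrent => //.
    by apply: sub_sigma_algebra; exact: eball_open.
  by apply: (cP k).2; rewrite invr_gt0.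
move: hits r_gt0; apply: filterS2 => omega hits Y_gt0.
apply: cvg0e_near_le => e e_gt0.
(* Dividing by sqrt J converts a sup norm bound into a Euclidean one; the
   added 1 keeps the divisor nonzero. *)
pose e' := e / (Num.sqrt J%:R + 1).
have sJ_gt0 : 0 < Num.sqrt J%:R + 1 :> R by rewrite ltr_wpDl.
have e'_gt0 : 0 < e' by rewrite divr_gt0.
have close k : exists i,
    `|row k (row_normalize H) - normalize (Y i omega)| <= e'.
  have [h h_gt0 hP] := normalize_mulmx_near H_ge0 H_free k (cP k).1 e'_gt0.
  (* The radius 1 / (trunc (1 / h) + 1) is smaller than h. *)
  have [i Wi] := hits k (Num.trunc h^-1).
  exists i; rewrite YE; apply: hP; apply: lt_trans Wi _.
  by rewrite invf_plt ?posrE// truncnS_gt// invr_ge0 ltW.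
have [i_ i_P] := choice close.
near=> n.
have i_lt : forall k, (i_ k < n)%N.
  near: n; exists (\max_k i_ k).+1 => // n /= max_lt k.
  by apply: leq_trans max_lt; rewrite ltnS leq_bigmax.
have n_gt0 : (0 < n)%N by near: n; exists 1%N.
have /andP[-> /le_trans] : (0 <= hausdorff_dist
    (conv_hull [set normalize (Y i omega) | i in `I_n])
    (conv_hull [set row k (row_normalize H) | k in [set: 'I_K]])
    <= (Num.sqrt J%:R * e')%:E)%E.
  apply: hausdorff_dist_bounds; first exact: ltW.
  - by exists (normalize (Y 0%N omega)); apply: sub_gen_smallest; exists 0%N.
  - apply: smallest_sub; first exact: conv_hull_convex.
    move=> _ [i _ <-]; rewrite YE; apply: normalize_mulmx_in_hull => //.
      exact: W_ge0.
    by rewrite -YE.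
  - apply: smallest_sub; first exact/convex_thickening/conv_hull_convex.
    move=> _ [k _ <-]; exists (normalize (Y (i_ k) omega)) => //.
    by apply: sub_gen_smallest; exists (i_ k) => //=; exact: i_lt.
apply; rewrite lee_fin mulrA ler_pdivrMr// mulrC ler_wpM2l ?(ltW e_gt0)//.
by rewrite lerDl.
Unshelve. all: by end_near.
Qed.
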